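(* Let $X$ be a reflexive real Banach space and $Y$ a real Hilbert space with induced norm $\|\cdot\|_Y$. Let $a\colon X\times Y\to\mathbb R$ be a continuous bilinear form, let $L\colon Y\to\mathbb R$ be a continuous linear functional with $L\neq 0$, and let $P\subset X$ be a closed convex set with $0_X\in P$. Suppose that there are a closed, convex and bounded set $P_A\subset X$ and a closed convex cone $P_C\subset P$ such that every $x\in P$ can be written as $x=x_A+x_C$ with $x_A\in P_A$, $x_C\in P_C$, and suppose that $$\inf_{\substack{x_C\in P_C\\ x_C\neq 0_X}}\ \sup_{\substack{y\in Y\\ y\neq 0_Y}}\ \frac{a(x_C,y)}{\|x_C\|_X\|y\|_Y}=c_*>0,\qquad C_*:=c_*^{-1}.$$ Let $y\in Y$ be such that $$L(y)>C_*\,\|\Pi_C\,y\|_X\,\|L\|_{Y^*}.$$ Then $$\zeta^*\le\frac{\mathcal J_A(y)+\varrho_A\,C_*\,\|a\|\,\|\Pi_C\,y\|_X}{L(y)-C_*\,\|\Pi_C\,y\|_X\,\|L\|_{Y^*}},\qquad\text{where}\quad \zeta^*:=\inf_{\substack{z\in Y\\ L(z)=1}}\ \sup_{x\in P} a(x,z).$$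
   Context: All cones have their vertex at zero. Notation: $\mathcal J_A(y):=\max_{x\in P_A}a(x,y)$; $\varrho_A:=\sup_{x\in P_A}\|x\|_X$; $\|a\|$ is the norm of the bilinear form $a$, i.e. the smallest constant with $|a(x,y)|\le\|a\|\,\|x\|_X\|y\|_Y$ for all $x\in X,y\in Y$; $\|L\|_{Y^*}$ is the dual norm of $L$. The symbol $\|\Pi_C\,y\|_X$ denotes the number $$\|\Pi_C\,y\|_X:=\Big(\max_{x\in P_C}\{-\|x\|_X^2+2a(x,y)\}\Big)^{1/2},\qquad y\in Y.$$ *)

(* Defs.v *)
From mathcomp Require Export all_boot all_order all_algebra.
From mathcomp Require Export all_classical all_reals all_analysis.

Set Implicit Arguments.
Unset Strict Implicit.
Unset Printing Implicit Defensive.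

Export Order.TTheory GRing.Theory Num.Theory.
Export numFieldNormedType.Exports.

#[global] Open Scope classical_set_scope.
#[global] Open Scope ring_scope.

(* A genuine maximum (resp. minimum): an attained value. The default 0 is
   returned when nothing is attained, so these are not sup and inf. *)
Definition maximum (R : realType) (A : set R) : R :=
  xget 0 (A `&` ubound A).

Definition minimum (R : realType) (A : set R) : R :=
  xget 0 (A `&` lbound A).

Definition continuous_dual (R : realType) (X : normedModType R) : set (X -> R^o) :=
  [set f | linear f /\ continuous f].

Definition dual_norm (R : realType) (X : normedModType R) (f : X -> R^o) : R :=
  sup [set `|f x| | x in [set x : X | `|x| <= 1]].

(* Surjectivity of the canonical embedding into the bidual. An element of the
   bidual is given by a function [Phi] of which only the restriction to
   [continuous_dual X] matters. *)
Definition reflexive_space (R : realType) (X : normedModType R) : Prop :=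
  forall Phi : (X -> R^o) -> R,
    (forall (k : R) f g, continuous_dual f -> continuous_dual g ->
       Phi (k *: f + g) = k * Phi f + Phi g) ->
    (exists C : R, forall f, continuous_dual f -> `|Phi f| <= C * dual_norm f) ->
    exists x : X, forall f, continuous_dual f -> Phi f = f x.

(* Positive multiples only: a nonempty closed cone then contains 0. *)
Definition cone (R : realType) (X : lmodType R) (C : set X) : Prop :=
  forall (t : R) x, 0 < t -> C x -> C (t *: x).

Section Functionals.
Variables (R : realType) (X Y : normedModType R) (a : X -> Y -> R^o).

(* [0 <= C] only matters if X or Y is trivial. *)
Definition bilinear_norm : R :=
  minimum [set C : R | 0 <= C /\ forall x y, `|a x y| <= C * `|x| * `|y|].

Definition support_max (PA : set X) (y : Y) : R :=
  maximum [set (a x y : R) | x in PA].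

Definition radius (PA : set X) : R := sup [set `|x| | x in PA].

Definition proj_norm (PC : set X) (y : Y) : R :=
  Num.sqrt (maximum [set - `|x| ^+ 2 + 2 * a x y | x in PC]).

(* Equal to +oo exactly when [PC] has no nonzero element (for continuous [a]). *)
Definition inf_sup (PC : set X) : \bar R :=
  ereal_inf [set ereal_sup
      [set (a x y / (`|x| * `|y|))%:E | y in [set y : Y | y != 0]]
    | x in PC `&` [set x | x != 0]].

Definition zeta (L : Y -> R^o) (P : set X) : \bar R :=
  ereal_inf [set ereal_sup [set (a x z)%:E | x in P]
    | z in [set z : Y | L z = 1]].

End Functionals.

(* Main.v *)
Require Import Defs.
From HB Require Import structures.
From mathcomp Require Import ring lra.

Set Implicit Arguments.
Unset Strict Implicit.
Unset Printing Implicit Defensive.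

(* By Riesz, a x v = <v, A x> for a linear A : X -> Y, and the inf-sup condition
   reads `|x| <= C_* `|A x| on PC. Let w be the projection of y on the closed
   convex cone generated by A(PC). By Moreau's decomposition y - w lies in the
   polar cone, that is a x (y - w) <= 0 on PC, and `|w|^2 = <w, y>. Since
   a x y <= p `|x| on PC, where p is the projection norm of y, we get
   <k, y> <= p C_* `|k| on A(PC), hence `|w| <= C_* p. Then
   z := (y - w) / L (y - w) is a competitor for zeta: its supremum over P is
   governed by PA alone, where a x (y - w) <= J_A(y) + rho_A `|a| C_* p.
   As maximum returns 0 when nothing is attained, the maxima over PA and PC
   have to be shown attained; this is where reflexivity of X enters, through
   Smulian's nested-set property. *)

(* One inequality suffices for homogeneity: the other one follows by applying it
   to t^-1. *)
Definition sublinear (R : realType) (V : lmodType R) (p : V -> R) : Prop :=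
  (forall u v, p (u + v) <= p u + p v) /\
  (forall t v, 0 < t -> p (t *: v) <= t * p v).

(** * Sublinear functionals and the Hahn-Banach theorem *)

Section HahnBanach.
Variables (R : realType) (V : lmodType R).
Implicit Types (p q : V -> R) (u v : V).

Lemma sublinear0 p : sublinear p -> p 0 = 0.
Proof.
move=> [pD pZ]; have := pZ 2%:R 0; have := pZ 2%:R^-1 0.
rewrite !scaler0 invr_gt0 ltr0n => /(_ isT) h1 /(_ isT) h2.
by lra.
Qed.

Lemma sublinear_geN p v : sublinear p -> - p (- v) <= p v.
Proof.
move=> sp; have := sp.1 v (- v); rewrite subrr (sublinear0 sp).
by rewrite -lerBlDr sub0r.
Qed.

(* q is the infimum of p (u + g.1) + g.2 over the convex cone G. *)
Lemma sublinear_infconv p (G : set (V * R)) : sublinear p -> G !=set0 ->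
  (forall g h, G g -> G h -> G (g.1 + h.1, g.2 + h.2)) ->
  (forall t g, 0 < t -> G g -> G (t *: g.1, t * g.2)) ->
  (forall g, G g -> 0 <= p g.1 + g.2) ->
  exists2 q, sublinear q & forall u g, G g -> q u <= p (u + g.1) + g.2.
Proof.
move=> sp [g0 Gg0] GD GZ Gp; pose S u := [set p (u + g.1) + g.2 | g in G].
have S0 u : S u !=set0 by exists (p (u + g0.1) + g0.2), g0.
have lbS u : has_lbound (S u).
  (* Subadditivity gives [p g.1 <= p (u + g.1) + p (- u)], and [p g.1 + g.2] is nonnegative on
     [G]. *)
  exists (- p (- u)) => _ [g Gg <-].
  have := sp.1 (u + g.1) (- u); rewrite addrAC subrr add0r => h.
  by have := Gp _ Gg; lra.
have infle u g : G g -> inf (S u) <= p (u + g.1) + g.2.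
  by move=> Gg; apply: ge_inf => //; exists g.
exists (fun u => inf (S u)) => //; split=> [u v|t v t0].
  rewrite -lerBlDr; apply: lb_le_inf => // _ [g Gg <-].
  rewrite lerBlDr -lerBlDl; apply: lb_le_inf => // _ [h Gh <-].
  rewrite lerBlDl; apply: (le_trans (infle _ _ (GD _ _ Gg Gh))) => /=.
  rewrite addrACA; have := sp.1 (u + g.1) (v + h.1); lra.
rewrite mulrC -ler_pdivrMr//; apply: lb_le_inf => // _ [g Gg <-].
rewrite ler_pdivrMr//; apply: (le_trans (infle _ _ (GZ _ _ t0 Gg))) => /=.
by rewrite -scalerDr mulrDl [g.2 * t]mulrC lerD2r mulrC; exact: sp.2.
Qed.

(** For fixed [v], lowering [p] along the ray of the pairs [(t *: v, - (t * p v))] gives a sublinear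
    [q <= p] with [q u <= p (u + v) - p v]. Minimality forces [q = p], which is superadditivity. *)
Lemma minimal_sublinear_linear p : sublinear p ->
  (forall q, sublinear q -> (forall v, q v <= p v) -> q = p) ->
  forall (k : R) u v, p (k *: u + v) = k * p u + p v.
Proof.
move=> sp pmin.
have pD u v : p (u + v) = p u + p v.
  apply: le_anti; rewrite sp.1 /=.
  pose G := [set g : V * R | exists2 t, 0 <= t & g = (t *: v, - (t * p v))].
  have [|||g|q sq qp] := @sublinear_infconv p G sp.
  - by exists (0, 0), 0; rewrite // scale0r mul0r oppr0.
  - move=> _ _ [t t0 ->] [s s0 ->]; exists (t + s); first exact: addr_ge0.
    by rewrite scalerDl mulrDl opprD.
  - move=> s _ s0 [t t0 ->]; exists (s * t); first by rewrite mulr_ge0// ltW.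
    by rewrite scalerA /= mulrN mulrA.
  - move=> [t + ->] /=; rewrite le_eqVlt => /orP[/eqP<-|t0].
      by rewrite scale0r mul0r (sublinear0 sp) subr0.
    rewrite subr_ge0 -ler_pdivlMl//.
    have := @sp.2 t^-1 (t *: v); rewrite invr_gt0 => /(_ t0).
    by rewrite scalerA mulVf ?gt_eqF// scale1r.
  have -> : p u = q u.
    rewrite (pmin q)// => w; have := qp w (0, 0); rewrite /= !addr0; apply.
    by exists 0; rewrite // scale0r mul0r oppr0.
  have := qp u (v, - p v); rewrite /= -lerBrDr; apply.
  by exists 1; rewrite // scale1r mul1r.
have pN v : p (- v) = - p v.
  by apply/eqP; rewrite -addr_eq0 -pD addNr (sublinear0 sp).
have pZ t v : 0 < t -> p (t *: v) = t * p v.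
  move=> t0; apply: le_anti; rewrite sp.2//= -ler_pdivlMl//.
  have := @sp.2 t^-1 (t *: v); rewrite invr_gt0 => /(_ t0).
  by rewrite scalerA mulVf ?gt_eqF// scale1r.
move=> k u v; rewrite pD; congr (_ + _).
have [k0|k0|->] := ltgtP k 0.
- have := pZ (- k) u; rewrite oppr_gt0 scaleNr pN => /(_ k0).
  by rewrite mulNr => /oppr_inj.
- exact: pZ.
- by rewrite scale0r mul0r (sublinear0 sp).
Qed.

(* A pointwise minimal sublinear functional below p, given by Zorn's lemma, is
   linear. *)
Lemma hahn_banach p : sublinear p -> exists f : V -> R,
  (forall (k : R) u v, f (k *: u + v) = k * f u + f v) /\ forall v, f v <= p v.
Proof.
move=> sp; pose T := {q : V -> R | sublinear q /\ forall v, q v <= p v}.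
(* The order is reversed, so that a maximal element for Zorn's lemma is a minimal functional. *)
pose le (q r : T) := `[< forall v, sval r v <= sval q v >].
have [|||A Atot|q qmax] := @Zorn T le.
- by move=> q; apply/asboolP.
- move=> q r s /asboolP qr /asboolP rs; apply/asboolP => v.
  exact: le_trans (rs v) (qr v).
- move=> [q Pq] [r Pr] /asboolP/= qr /asboolP/= rq; apply: eq_exist.
  by apply/funext => v; apply: le_anti; rewrite qr rq.
(* The empty chain is bounded by [p] itself, a nonempty one by its pointwise infimum. *)
- have [[q0 Aq0]|/set0P/negP/negPn/eqP ->] := pselect (A !=set0); last first.
    by exists (exist _ p (conj sp (fun=> lexx _))) => s [].
  pose S v := [set sval q v | q in A].
  have S0 v : S v !=set0 by exists (sval q0 v), q0.
  have lbS v : has_lbound (S v).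
    exists (- p (- v)) => _ [q Aq <-]; have [sq qp] := svalP q.
    by apply: le_trans (sublinear_geN _ sq); rewrite lerN2.
  have infle v (q : T) : A q -> inf (S v) <= sval q v.
    by move=> Aq; apply: ge_inf => //; exists q.
  have sinf : sublinear (fun v => inf (S v)).
    split=> [u v|t v t0].
      rewrite -lerBlDr; apply: lb_le_inf => // _ [q Aq <-].
      rewrite lerBlDr -lerBlDl; apply: lb_le_inf => // _ [r Ar <-].
      rewrite lerBlDl.
      (* The smaller of the two chain members serves for both arguments. *)
      have [/asboolP qr|/asboolP rq] := Atot _ _ Aq Ar.
        apply: (le_trans (infle _ _ Ar)); apply: (le_trans ((svalP r).1.1 _ _)).
        by rewrite lerD2r.
      apply: (le_trans (infle _ _ Aq)); apply: (le_trans ((svalP q).1.1 _ _)).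
      by rewrite lerD2l.
    rewrite mulrC -ler_pdivrMr//; apply: lb_le_inf => // _ [q Aq <-].
    rewrite ler_pdivrMr//; apply: (le_trans (infle _ _ Aq)).
    by rewrite mulrC; exact: (svalP q).1.2.
  have infp v : inf (S v) <= p v.
    exact: le_trans (infle _ _ Aq0) ((svalP q0).2 v).
  have Pinf : sublinear (fun v => inf (S v)) /\ forall v, inf (S v) <= p v by [].
  by exists (exist _ _ Pinf : T) => q Aq; apply/asboolP => v; exact: infle.
- have [sq qp] := svalP q; exists (sval q); split=> //.
  apply: minimal_sublinear_linear => // r sr rq.
  have rp v : r v <= p v by exact: le_trans (rq v) (qp v).
  have Pr : sublinear r /\ forall v, r v <= p v by [].
  have <- := qmax (exist _ r Pr : T); first by [].
  by apply/asboolP.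
Qed.

End HahnBanach.

(** * Separation of a point from a convex set *)

Section Separation.
Variables (R : realType) (X : normedModType R).
Implicit Types (D : set X) (x z : X).

Lemma convex_set_comb (V : lmodType R) (D : set V) (s t : R) (u v : V) :
  convex_set D -> D u -> D v -> 0 <= s -> 0 <= t -> s + t = 1 ->
  D (s *: u + t *: v).
Proof.
move=> cD Du Dv s0 t0 st1.
have s1 : s <= 1 by rewrite -st1 lerDl.
have : D (s *: u + (1 - s) *: v).
  exact: set_mem (cD u v (Itv01 s0 s1) (mem_set Du) (mem_set Dv)).
by rewrite -st1 addrAC subrr add0r.
Qed.

Lemma comb_convex_set (V : lmodType R) (D : set V) :
  (forall (s t : R) (u v : V), D u -> D v -> 0 <= s -> 0 <= t -> s + t = 1 ->
  D (s *: u + t *: v)) -> convex_set D.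
Proof.
move=> cD u v l /[!inE] Du Dv; apply: (cD l%:num (1 - l%:num) u v) => //.
by rewrite addrC subrK.
Qed.

(* Hahn-Banach for the largest sublinear q <= `|.| with q (z - x) <= - d on D. *)
Lemma hahn_banach_separation D x (d : R) : convex_set D -> D !=set0 ->
  (forall z, D z -> d <= `|z - x|) ->
  exists f : X -> R, [/\ forall (k : R) u v, f (k *: u + v) = k * f u + f v,
    forall v, `|f v| <= `|v| & forall z, D z -> f z <= f x - d].
Proof.
move=> cD [z0 Dz0] dD.
have sN : sublinear (fun v : X => `|v|).
  split=> [u v|t v t0]; first exact: ler_normD.
  by rewrite normrZ gtr0_norm.
(* The cone generated by the pairs [(x - z, - d)] with [z] in [D]: the member with [t = 1] will
   force [q (z - x) <= - d], and [d <= |z - x|] is what makes the infimum nonnegative at 0. *)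
pose G := [set g : X * R | exists t z,
  [/\ 0 <= t, D z & g = (- (t *: (z - x)), - (t * d))]].
have [|||g|q sq qG] := @sublinear_infconv _ _ _ G sN.
- by exists (- (0 *: (z0 - x)), - (0 * d)), 0, z0.
- move=> _ _ [t [z [t0 Dz ->]]] [s [w [s0 Dw ->]]] /=.
  (* The new point of [D] is the mean of [z] and [w] with weights proportional to [t] and [s]; both
     weights may vanish. *)
  have [ts0|ts0] := eqVneq (t + s) 0.
    have /eqP := ts0; rewrite paddr_eq0// => /andP[/eqP-> /eqP->].
    exists 0, z; split => //.
    by rewrite !scale0r !mul0r !oppr0 !addr0.
  exists (t + s), (t / (t + s) *: z + s / (t + s) *: w); split.
  + exact: addr_ge0.
  + apply: convex_set_comb => //; rewrite ?divr_ge0 ?addr_ge0//.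
    by rewrite -mulrDl divff.
  + rewrite mulrDl !opprD; congr (_, _).
    rewrite -!opprD; congr (- _).
    rewrite [RHS]scalerBr [X in _ = X - _]scalerDr !scalerA ![(t + s) * _]mulrC !divfK//.
    by rewrite scalerDl !scalerBr opprD addrACA.
- move=> s _ s0 [t [z [t0 Dz ->]]] /=; exists (s * t), z; split => //.
    by rewrite mulr_ge0// ltW.
  by rewrite scalerN scalerA mulrN mulrA.
- move=> [t [z [t0 Dz ->]]] /=.
  by rewrite normrN normrZ ger0_norm// subr_ge0 ler_wpM2l// dD.
have [f [fP fq]] := hahn_banach sq; exists f.
have f0 : f 0 = 0 by have := fP (-1) 0 0; rewrite scaler0 addr0; lra.
have fN v : f (- v) = - f v.
  by have := fP (-1) v 0; rewrite f0 !addr0 scaleN1r mulN1r.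
have fle v : f v <= `|v|.
  apply: (le_trans (fq v)); have := qG v (0, 0); rewrite /= !addr0; apply.
  by exists 0, z0; split => //; rewrite scale0r mul0r !oppr0.
split => // [v|z Dz].
  by rewrite ler_norml fle andbT lerNl -fN -normrN fle.
have := qG (z - x) (- (1 *: (z - x)), - (1 * d)).
rewrite /= scale1r subrr normr0 add0r mul1r => qle.
have : f (z - x) <= - d.
  by apply: (le_trans (fq _)); apply: qle; exists 1, z; split; rewrite // scale1r mul1r.
by have := fP 1 z (- x); rewrite scale1r fN mul1r => ->; lra.
Qed.

End Separation.

(** * Continuous functionals, nested sets in reflexive spaces and attained maxima *)

Section WeakCompactness.
Variables (R : realType) (X : normedModType R).

Lemma continuous_dual_bound (f : X -> R^o) : continuous_dual f ->
  exists2 M, 0 <= M & forall x, `|f x| <= M * `|x|.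
Proof.
move=> [lf cf].
pose g : {linear X -> R^o} := HB.pack f (GRing.isLinear.Build _ _ _ _ f lf).
have /linear_boundedP/pinfty_ex_gt0[M M0 Mf] :=
  @continuous_linear_bounded _ _ _ 0 g (cf 0).
by exists M; [exact: ltW|exact: Mf].
Qed.

Lemma dual_norm_bound (f : X -> R^o) x : continuous_dual f ->
  `|f x| <= dual_norm f * `|x|.
Proof.
move=> df; have [M M0 Mf] := continuous_dual_bound df; have lf := df.1.
have fZ k u : f (k *: u) = k * f u.
  have f0 : f 0 = 0 by have := lf (-1) 0 0; rewrite scaler0 addr0 scaleN1r; lra.
  by have := lf k u 0; rewrite f0 !addr0.
have [->|x0] := eqVneq x 0.
  by have := fZ 0 0; rewrite scale0r mul0r => ->; rewrite !normr0 mulr0.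
have nx0 : 0 < `|x| by rewrite normr_gt0.
rewrite -ler_pdivrMr//; apply: ub_le_sup.
  exists M => _ [u /= u1 <-]; apply: (le_trans (Mf u)).
  by rewrite -[leRHS]mulr1 ler_wpM2l.
exists (`|x|^-1 *: x) => /=.
  by rewrite normrZ ger0_norm ?invr_ge0// mulVf// gt_eqF.
by rewrite fZ normrM ger0_norm ?invr_ge0// mulrC.
Qed.

Lemma dual_norm_ge0 (f : X -> R^o) : continuous_dual f -> 0 <= dual_norm f.
Proof.
move=> df; have [M M0 Mf] := continuous_dual_bound df.
apply: (le_trans (normr_ge0 (f 0))); apply: ub_le_sup.
  exists M => _ [u /= u1 <-]; apply: (le_trans (Mf u)).
  by rewrite -[leRHS]mulr1 ler_wpM2l.
by exists 0; rewrite //= normr0.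
Qed.

(** The image filter has a cluster point in the compact segment [[-M, M]], and an ultrafilter
    converges to each of its cluster points. *)
Lemma ultra_bounded_cvg (U : set_system nat) (u : nat -> R) (M : R) :
  UltraFilter U -> (forall n, `|u n| <= M) -> exists l : R, u @ U --> l.
Proof.
move=> UU uM.
have [|l [_ ul]] := @segment_compact R (- M) M (u @ U) (fmap_proper_filter u _).
  apply: (@filterS _ U _ setT) => [n _|]; last exact: filterT.
  by rewrite /= in_itv/= -ler_norml.
exists l => A lA /=; have [//|UnA] := in_ultra_setVsetC (u @^-1` A) UU.
by have [? []] := ul (~` A) A UnA lA.
Qed.

(* [Phi f] is the limit of [f (x_ n)] along a free ultrafilter, where
   [x_ n] is in [D n]; reflexivity represents [Phi] by a point, which no
   continuous functional separates from [D m]. *)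
Lemma reflexive_nested_nonempty (D : nat -> set X) (M : R) :
  reflexive_space X ->
  (forall n, closed (D n)) -> (forall n, convex_set (D n)) ->
  (forall n, D n !=set0) -> (forall m n, (m <= n)%N -> D n `<=` D m) ->
  (forall x, D 0%N x -> `|x| <= M) -> exists x, forall n, D n x.
Proof.
move=> rX clD cvD D0 decrD DM.
have [x_ Dx] := choice D0.
have xM n : `|x_ n| <= M by apply: DM; apply: decrD (Dx n).
have M0 : 0 <= M by apply: le_trans (xM 0%N).
have [U [UU ooU]] := @ultraFilterLemma nat \oo _.
pose Phi (f : X -> R^o) : R := lim ((fun n => f (x_ n) : R) @ U).
have fM f : continuous_dual f -> forall n, `|f (x_ n)| <= M * dual_norm f.
  move=> df n; apply: (le_trans (dual_norm_bound _ df)).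
  by rewrite mulrC ler_wpM2r ?dual_norm_ge0.
have cvgPhi f : continuous_dual f -> (fun n => f (x_ n) : R) @ U --> Phi f.
  move=> df; have [l fl] := ultra_bounded_cvg UU (fM _ df).
  by rewrite /Phi (cvg_lim _ fl).
have [|| x Phix] := rX Phi.
- move=> k f g df dg; apply: cvg_lim => //.
  by apply: cvgD; [apply: cvgMr; exact: cvgPhi|exact: cvgPhi].
- exists M => f df; rewrite ler_norml; apply/andP; split.
    apply: (cvgr_to_ge (cvgPhi _ df)); apply: filterE => n.
    by have := fM _ df n; rewrite ler_norml => /andP[].
  apply: (cvgr_to_le (cvgPhi _ df)); apply: filterE => n.
  by have := fM _ df n; rewrite ler_norml => /andP[].
exists x => m; apply: contrapT => Dmx.
have [d d0 Dd] : exists2 d : R, 0 < d & forall z, D m z -> d <= `|z - x|.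
  have : nbhs x (~` D m) by apply: open_nbhs_nbhs; split => //; exact: closed_openC.
  move=> /nbhs_ballP[d /= d0 dD]; exists d => // z Dz; rewrite leNgt.
  apply/negP => zx; apply: (dD z) => //.
  by rewrite -ball_normE /ball_ /= distrC.
have [f [fP f1 fD]] := hahn_banach_separation (cvD m) (D0 m) Dd.
have df : continuous_dual (f : X -> R^o).
  split => // y; apply/cvgrPdist_lt => e e0.
  have fB z : f y - f z = f (y - z).
    by have := fP (-1) z y; rewrite scaleN1r addrC => ->; rewrite mulN1r addrC.
  near=> z; rewrite fB; apply: (le_lt_trans (f1 _)).
  by near: z; exact: cvgr_dist_lt.
(* From index [m] on, [x_ n] lies in [D m], so the bound passes to the limit; it contradicts
   [Phi f = f x]. *)
have : Phi f <= f x - d.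
  apply: (cvgr_to_le (cvgPhi _ df)); apply: ooU; exists m => // n /= mn.
  by apply: fD; exact: decrD (Dx n).
by rewrite Phix// lerBrDr gerDl leNgt d0.
Unshelve. all: by end_near. Qed.

(** With [m] the supremum of [F], the superlevel sets of height [m - 1/(n+1)] are nested, nonempty,
    closed, convex and bounded; [F] equals [m] at a common point. *)
Lemma maximum_attained (D : set X) (F : X -> R) (M B : R) :
  reflexive_space X -> D !=set0 ->
  (forall s, closed (D `&` [set x | s <= F x])) ->
  (forall s, convex_set (D `&` [set x | s <= F x])) ->
  (forall x, D x -> `|x| <= M) -> (forall x, D x -> F x <= B) ->
  exists2 x, D x & forall z, D z -> F z <= F x.
Proof.
move=> rX [x0 Dx0] clD cvD DM FB.
have supF : has_sup (F @` D).
  by split; [exists (F x0), x0|exists B => _ [z Dz <-]; exact: FB].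
pose m := sup (F @` D).
have [|||n k nk|z [Dz _]|x Dx] := @reflexive_nested_nonempty
  (fun n => D `&` [set x | m - n.+1%:R^-1 <= F x]) M rX.
- by move=> n; exact: clD.
- by move=> n; exact: cvD.
- move=> n; have n0 : 0 < n.+1%:R^-1 :> R by rewrite invr_gt0.
  by have [_ [z Dz <-] /ltW mz] := sup_adherent n0 supF; exists z.
- move=> z [Dz /= mz]; split=> //; apply: le_trans mz.
  by rewrite lerB// lef_pV2 ?posrE// ler_nat.
- exact: DM.
exists x; first exact: (Dx 0%N).1.
move=> z Dz; apply: (@le_trans _ _ m).
  by apply: ub_le_sup; [exact: supF.2|exists z].
apply/ler_addgt0Pr => e e0.
have [n ne] : exists n, n.+1%:R^-1 < e.
  exists (Num.truncn e^-1); rewrite invf_plt ?posrE//.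
  exact: truncnS_gt.
by have [_ /=] := Dx n; rewrite lerBlDr => /le_trans; apply; rewrite lerD2l ltW.
Qed.

Lemma maximum_eq (A : set R) (m : R) : A m -> ubound A m -> maximum A = m.
Proof.
move=> Am ubm; have [Ax ubx] : (A `&` ubound A) (maximum A).
  by apply: xgetPex; exists m.
by apply: le_anti; rewrite ubm//= ubx.
Qed.

End WeakCompactness.

(** * Closures in normed spaces *)

Lemma closure_norm_le (R : realType) (V : normedModType R) (A : set V) u :
  closure A u <-> forall e : R, 0 < e -> exists2 v, A v & `|u - v| < e.
Proof.
split=> [Au e e0|Au B /nbhs_ballP[e /= e0 eB]].
  have [v [Av uv]] := Au _ (nbhsx_ballx u e e0).
  by exists v => //; move: uv; rewrite -ball_normE.
have [v Av uv] := Au e e0.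
by exists v; split => //; apply: eB; rewrite -ball_normE.
Qed.

Lemma closure_convex (R : realType) (V : normedModType R) (A : set V) :
  convex_set A -> convex_set (closure A).
Proof.
move=> cA; apply: comb_convex_set => s t u v /closure_norm_le Au.
move=> /closure_norm_le Av s0 t0 st1; apply/closure_norm_le => e e0.
have [x Ax ux] := Au _ e0; have [y Ay vy] := Av _ e0.
exists (s *: x + t *: y); first exact: convex_set_comb.
rewrite opprD addrACA -!scalerBr; apply: (le_lt_trans (ler_normD _ _)).
rewrite !normrZ !ger0_norm// -[ltRHS]mul1r -st1 mulrDl.
move: s0; rewrite le_eqVlt => /orP[/eqP s0|s0].
  have t1 : t = 1 by rewrite -st1 -s0 add0r.
  by rewrite -s0 t1 !mul0r !add0r !mul1r.
by apply: ltr_leD; [rewrite ltr_pM2l|rewrite ler_wpM2l// ltW].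
Qed.

(** * Hilbert spaces: projection, Riesz representation and polar cones *)

Section Hilbert.
Variables (R : realType) (Y : completeNormedModType R) (ip : Y -> Y -> R).
Hypothesis ipC : forall u v, ip u v = ip v u.
Hypothesis ipP : forall k u v w, ip (k *: u + v) w = k * ip u w + ip v w.
Hypothesis ip_norm : forall u, ip u u = `|u| ^+ 2.

Lemma ip0l w : ip 0 w = 0.
Proof. by have := ipP (-1) 0 0 w; rewrite scaler0 addr0; lra. Qed.

Lemma ipDl u v w : ip (u + v) w = ip u w + ip v w.
Proof. by rewrite -[u]scale1r ipP scale1r mul1r. Qed.

Lemma ipZl k u w : ip (k *: u) w = k * ip u w.
Proof. by rewrite -[_ *: _]addr0 ipP ip0l addr0. Qed.

Lemma ipNl u w : ip (- u) w = - ip u w.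
Proof. by rewrite -scaleN1r ipZl mulN1r. Qed.

Lemma ipDr u v w : ip w (u + v) = ip w u + ip w v.
Proof. by rewrite ![ip w _]ipC ipDl. Qed.

Lemma ipZr k u w : ip w (k *: u) = k * ip w u.
Proof. by rewrite ![ip w _]ipC ipZl. Qed.

Lemma ipNr u w : ip w (- u) = - ip w u.
Proof. by rewrite ![ip w _]ipC ipNl. Qed.

Lemma ip_cauchy_schwarz u v : ip u v <= `|u| * `|v|.
Proof.
have [->|v0] := eqVneq v 0; first by rewrite ipC ip0l normr0 mulr0.
have nv : 0 < `|v| by rewrite normr_gt0.
have [->|u0] := eqVneq u 0; first by rewrite ip0l normr0 mul0r.
have nu : 0 < `|u| by rewrite normr_gt0.
(* This square expands to [2 |u| |v| (|u| |v| - ip u v)]. *)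
have := sqr_ge0 `| `|v| *: u - `|u| *: v|; rewrite -ip_norm.
rewrite !(ipDl, ipDr, ipNl, ipNr, ipZl, ipZr) !ip_norm (ipC v u) => h.
have : 0 <= (`|u| * `|v|) * (`|u| * `|v| - ip u v) by nra.
by rewrite pmulr_rge0 ?mulr_gt0// subr_ge0.
Qed.

Lemma parallelogram (u v w : Y) :
  `|u - v| ^+ 2 = 2 * `|w - u| ^+ 2 + 2 * `|w - v| ^+ 2
    - 4 * `|w - (2^-1 *: u + 2^-1 *: v)| ^+ 2.
Proof.
rewrite -!ip_norm !(ipDl, ipDr, ipNl, ipNr, ipZl, ipZr).
by rewrite (ipC v u) (ipC u w) (ipC v w); field.
Qed.

Lemma norm_subZ (u v : Y) (t : R) :
  `|u - t *: v| ^+ 2 = `|u| ^+ 2 - 2 * t * ip v u + t ^+ 2 * `|v| ^+ 2.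
Proof.
rewrite -!ip_norm !(ipDl, ipDr, ipNl, ipNr, ipZl, ipZr) (ipC u v).
by ring.
Qed.

(** A minimizing sequence is Cauchy by the parallelogram identity. Its limit [l] satisfies the
    variational inequality because a short move from [l] towards [k] cannot decrease the distance to
    [y]. *)
Lemma hilbert_projection (C : set Y) y : closed C -> convex_set C ->
  C !=set0 -> exists2 l, C l & forall k, C k -> ip (k - l) (y - l) <= 0.
Proof.
move=> clC cvC [k0 Ck0].
pose S := [set `|y - k| ^+ 2 | k in C]; pose m := inf S.
have infS : has_inf S.
  by split; [exists (`|y - k0| ^+ 2), k0|exists 0 => _ [k _ <-]; exact: sqr_ge0].
have mle k : C k -> m <= `|y - k| ^+ 2.
  by move=> Ck; apply: ge_inf; [exact: infS.2|exists k].
have /choice[k_ k_P] (n : nat) :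
    exists k, C k /\ `|y - k| ^+ 2 < m + n.+1%:R^-1.
  have n0 : 0 < n.+1%:R^-1 :> R by rewrite invr_gt0.
  by have [_ [k Ck <-] km] := inf_adherent n0 infS; exists k.
(* Both squared distances to [y] are below [m + 1/(N+1)], while the midpoint stays in [C] and has
   squared distance at least [m]. *)
have kdist N n : (N <= n)%N -> `|k_ N - k_ n| ^+ 2 <= 4 * N.+1%:R^-1.
  move=> Nn; have [CN mN] := k_P N; have [Cn mn] := k_P n.
  rewrite (parallelogram _ _ y).
  have := mle _ (convex_set_comb cvC CN Cn _ _ _) => /(_ 2^-1 2^-1).
  have -> : 2^-1 + 2^-1 = 1 :> R by field.
  rewrite invr_ge0 ler0n => /(_ isT isT erefl) mN2.
  have : n.+1%:R^-1 <= N.+1%:R^-1 :> R by rewrite lef_pV2 ?posrE// ler_nat.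
  move: mN mn mN2; move: (N.+1%:R^-1) (n.+1%:R^-1) => eN en.
  move: (`|_| ^+ 2) (`|_| ^+ 2) (`|_| ^+ 2) => x1 x2 x3.
  lra.
have kcvg : cvg (k_ @ \oo).
  apply: cauchy_cvg; apply: cauchy_exP => e /= e0.
  pose N := Num.truncn (4 / e ^+ 2); exists (k_ N), N => // n /= Nn.
  rewrite -ball_normE /ball_ /= -(@ltr_pXn2r _ 2)// ?nnegrE// ?(ltW e0)//.
  apply: (le_lt_trans (kdist _ _ Nn)).
  rewrite ltr_pdivrMr// mulrC -ltr_pdivrMr ?exprn_gt0//.
  exact: truncnS_gt.
set l := lim (k_ @ \oo) in kcvg.
have Cl : C l.
  apply: (closed_cvg _ clC _ _ kcvg); apply: nearW => n; exact: (k_P n).1.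
have lm : `|y - l| ^+ 2 <= m.
  apply/ler_addgt0Pr => e e0.
  have : (fun n => `|y - k_ n| * `|y - k_ n|) @ \oo --> `|y - l| * `|y - l|.
    by apply: cvgM; apply: cvg_norm; apply: cvgB => //; exact: cvg_cst.
  move=> /cvgr_to_le; apply; exists (Num.truncn e^-1) => // n /= en.
  apply: (le_trans (ltW (k_P n).2)); rewrite lerD2l.
  rewrite invf_ple ?posrE//; apply/ltW/(lt_le_trans (truncnS_gt _)).
  by rewrite ler_nat.
exists l => // k Ck; rewrite leNgt; apply/negP => s0.
set s := ip _ _ in s0; pose N := `|k - l| ^+ 2.
have N0 : 0 <= N by exact: sqr_ge0.
(* This step lies in [(0, 1]] and has [t * N <= s < 2 * s], so the change [t * (t * N - 2 * s)] of
   the squared distance is negative. *)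
pose t := s / (s + N).
have t0 : 0 < t by rewrite divr_gt0// ltr_wpDr.
have t1 : t <= 1 by rewrite ler_pdivrMr ?mul1r ?lerDl// ltr_wpDr.
have t1' : 0 <= 1 - t by rewrite subr_ge0.
have tt1 : t + (1 - t) = 1 by rewrite addrC subrK.
have := le_trans lm (mle _ (convex_set_comb cvC Ck Cl (ltW t0) t1' tt1)).
have -> : y - (t *: k + (1 - t) *: l) = (y - l) - t *: (k - l).
  by rewrite scalerBl scale1r scalerBr !opprD !opprK -addrA; congr (_ + _); rewrite addrCA.
rewrite norm_subZ -/s -/N => h.
have : 0 <= t * (t * N - 2 * s).
  by move: h; rewrite -addrA lerDl; congr (0 <= _); ring.
rewrite pmulr_rge0// subr_ge0 leNgt => /negP; apply.
have : t * N <= s by rewrite mulrAC ler_pdivrMr ?ltr_wpDr// ler_pM2l// lerDr ltW.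
lra.
Qed.

(** The point [l] of least norm in the hyperplane [f = 1] is orthogonal to the kernel of [f]; the
    representer is a multiple of it. *)
Lemma riesz (f : Y -> R^o) : continuous_dual f ->
  exists r, forall v, f v = ip v r.
Proof.
move=> [lf cf].
have fP k u v : f (k *: u + v) = k * f u + f v by exact: lf.
have f0 : f 0 = 0 by have := fP (-1) 0 0; rewrite scaler0 addr0; lra.
have fZ k u : f (k *: u) = k * f u by rewrite -[_ *: _]addr0 fP f0 addr0.
have [fz|/existsNP[v0 /eqP fv0]] := pselect (forall v, f v = 0).
  by exists 0 => v; rewrite ipC ip0l fz.
pose C := [set v | f v = 1].
have [|||l Cl lP] := @hilbert_projection C 0.
- apply: (@preimage_closed _ _ f [set 1]); first by move=> ? _; exact: cf.
  exact: closed_eq.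
- apply: comb_convex_set => s t u v fu fv _ _ st1.
  by rewrite /C/= fP fZ fu fv !mulr1.
- by exists ((f v0)^-1 *: v0); rewrite /C/= fZ mulVf.
have l0 : l != 0.
  by apply/eqP => l0; move: Cl; rewrite /C/= l0 f0 => /esym/eqP; rewrite oner_eq0.
(* The point [l - u] is again in the hyperplane, so it may be tested in the projection
   inequality. *)
have kerl u : f u = 0 -> ip u l <= 0.
  move=> fu; have := lP (-1 *: u + l).
  rewrite /C/= fP fu mulr0 add0r addrK sub0r scaleN1r ipNl ipNr opprK.
  by apply.
have kerl0 u : f u = 0 -> ip u l = 0.
  move=> fu; apply: le_anti; rewrite kerl//= -oppr_le0 -ipNl kerl//.
  by rewrite -scaleN1r fZ fu mulr0.
(* Since [v - f v *: l] is in the kernel, [ip v l = f v * |l|^2]; this fixes the factor. *)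
exists (`|l| ^- 2 *: l) => v.
have := kerl0 (v - f v *: l); rewrite addrC -scaleNr fP Cl mulr1 addNr.
rewrite ipP ip_norm ipZr => /(_ erefl) h.
have -> : ip v l = f v * `|l| ^+ 2 by lra.
by rewrite mulrC mulfK// expf_neq0// normr_eq0.
Qed.

(** The bound on [ip k y] extends to the closure of [K], where the projection [w] lies; testing with
    0 gives [|w|^2 <= ip w y <= M |w|]. *)
Lemma polar_cone_correction (K : set Y) y M : K 0 -> convex_set K -> cone K ->
  (forall k, K k -> ip k y <= M * `|k|) -> 0 <= M ->
  exists2 w, `|w| <= M & forall k, K k -> ip k (y - w) <= 0.
Proof.
move=> K0 cvK coK yM M0.
have [|||w Kw wP] := @hilbert_projection (closure K) y.
- exact: closed_closure.
- exact: closure_convex.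
- by exists 0; exact: subset_closure.
have wyw : 0 <= ip w (y - w).
  by have := wP 0 (subset_closure K0); rewrite sub0r ipNl oppr_le0.
exists w => [|k Kk]; last first.
  rewrite leNgt; apply/negP => s0.
  set s := ip k (y - w) in s0.
  (* With this multiple, [ip (t *: k - w) (y - w)] equals 1, against the projection inequality. *)
  pose t := (ip w (y - w) + 1) / s.
  have t0 : 0 < t by rewrite divr_gt0// ltr_wpDl.
  have := wP (t *: k) (subset_closure (coK _ _ t0 Kk)).
  rewrite ipDl ipNl ipZl -/s /t divfK ?gt_eqF//; lra.
have wy : ip w y <= M * `|w|.
  apply/ler_addgt0Pr => e e0.
  (* Replacing [w] by [k] costs at most [d * |y|] in the inner product and [d * M] in the bound. *)
  pose d := e / (`|y| + M + 1).
  have d0 : 0 < d by rewrite divr_gt0// ltr_wpDl// addr_ge0.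
  have [k Kk wk] := (closure_norm_le _ _).1 Kw d d0.
  have := ip_cauchy_schwarz (w - k) y; rewrite ipDl ipNl => h1.
  have h2 := yM k Kk.
  have h3 : `|k| <= `|w| + `|w - k|.
    by rewrite -[X in `|X| <= _](subKr w) (le_trans (ler_normB _ _)).
  have h4 : d * (`|y| + M + 1) = e.
    by rewrite divfK// gt_eqF// ltr_wpDl// addr_ge0.
  have h5 : M * `|k| <= M * (`|w| + d).
    by rewrite ler_wpM2l// (le_trans h3)// lerD2l ltW.
  have h6 : `|w - k| * `|y| <= d * `|y| by rewrite ler_wpM2r// ltW.
  by move: h4 h1 h2 h5 h6; rewrite !mulrDr mulr1 (mulrC d M); lra.
have [->|w0] := eqVneq w 0; first by rewrite normr0.
have nw : 0 < `|w| by rewrite normr_gt0.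
rewrite -(ler_pM2r nw) -expr2 -ip_norm (le_trans _ wy)//.
by move: wyw; rewrite ipDr ipNr subr_ge0.
Qed.

End Hilbert.

(** * Closed cones and bounded sets *)

Lemma closed_cone0 (R : realType) (X : normedModType R) (C : set X) :
  closed C -> cone C -> C !=set0 -> C 0.
Proof.
move=> clC coC [x Cx]; apply: clC; apply/closure_norm_le => e e0.
have nx : 0 < `|x| + 1 by rewrite ltr_wpDl.
have t0 : 0 < e / (`|x| + 1) by rewrite divr_gt0.
exists (e / (`|x| + 1) *: x); first exact: coC.
rewrite sub0r normrN normrZ gtr0_norm// mulrAC ltr_pdivrMr// ltr_pM2l//.
by rewrite ltrDl.
Qed.

Lemma radius_bound (R : realType) (X : normedModType R) (A : set X) x :
  bounded_set A -> A x -> `|x| <= radius A.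
Proof.
move=> /pinfty_ex_gt0[M M0 AM] Ax; apply: ub_le_sup; last by exists x.
by exists M => _ [z Az <-]; exact: AM.
Qed.

(** * Continuous bilinear forms and the maxima built from them *)

Section BilinearForm.
Variables (R : realType) (X Y : normedModType R) (a : {bilinear X -> Y -> R^o}).
Hypothesis ha : continuous (fun p : X * Y => a p.1 p.2 : R^o).

Lemma bilinearDl u v y : a (u + v) y = a u y + a v y.
Proof. exact: linearDl. Qed.

Lemma bilinearDr x u v : a x (u + v) = a x u + a x v.
Proof. exact: linearDr. Qed.

Lemma bilinearZl k u y : a (k *: u) y = k * a u y.
Proof. exact: linearZl_LR. Qed.

Lemma bilinearZr k x u : a x (k *: u) = k * a x u.
Proof. exact: linearZr_LR. Qed.

Lemma bilinear0l y : a 0 y = 0.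
Proof. exact: linear0l. Qed.

Lemma bilinear0r x : a x 0 = 0.
Proof. exact: linear0r. Qed.

(** Continuity at the origin gives [|a| <= 1] on a ball of radius [d]; both arguments are rescaled
    to norm [d / 2]. *)
Lemma continuous_bilinear_bound :
  exists2 C, 0 <= C & forall x y, `|a x y| <= C * `|x| * `|y|.
Proof.
have := @ha (0, 0) => /cvgrPdist_le/(_ _ ltr01)/nbhs_ballP[d /= d0 ad].
have d20 : 0 < d / 2 by rewrite divr_gt0.
have nball (V : normedModType R) (v : V) : v != 0 ->
    ball 0 d ((d / 2 / `|v|) *: v).
  move=> v0; rewrite -ball_normE /ball_ /= sub0r normrN normrZ.
  have nv : 0 < `|v| by rewrite normr_gt0.
  rewrite gtr0_norm ?divr_gt0// divfK ?gt_eqF//; lra.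
exists ((d / 2) ^- 2); first by rewrite invr_ge0 sqr_ge0.
move=> x y; have [->|x0] := eqVneq x 0.
  by rewrite bilinear0l !normr0 mulr0 mul0r.
have [->|y0] := eqVneq y 0; first by rewrite bilinear0r !normr0 mulr0.
have nx : 0 < `|x| by rewrite normr_gt0.
have ny : 0 < `|y| by rewrite normr_gt0.
have := ad (_, _) (conj (nball _ _ x0) (nball _ _ y0)).
rewrite /= bilinear0l sub0r normrN bilinearZl bilinearZr.
have dx : 0 < d / 2 / `|x| by rewrite divr_gt0.
have dy : 0 < d / 2 / `|y| by rewrite divr_gt0.
rewrite normrM (gtr0_norm dx) normrM (gtr0_norm dy) => h.
have -> : `|a x y| = (d / 2) ^- 2 * `|x| * `|y| *
    (d / 2 / `|x| * (d / 2 / `|y| * `|a x y|)).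
  by field; rewrite !gt_eqF.
by rewrite ler_piMr// !mulr_ge0// invr_ge0 sqr_ge0.
Qed.

(** The infimum of the admissible constants is itself admissible, so [minimum] does not fall back on
    its default. *)
Lemma bilinear_norm_bound : 0 <= bilinear_norm a /\
  forall x y, `|a x y| <= bilinear_norm a * `|x| * `|y|.
Proof.
pose B := [set C : R | 0 <= C /\ forall x y, `|a x y| <= C * `|x| * `|y|].
have [C0 C00 aC0] := continuous_bilinear_bound.
have lbB : has_lbound B by exists 0 => C [].
have B0 : B !=set0 by exists C0.
have Binf : B (inf B).
  split=> [|x y]; first by apply: lb_le_inf => // C [].
  have [xy0|xy0] := eqVneq (`|x| * `|y|) 0.
    by have := aC0 x y; rewrite -!mulrA xy0 !mulr0.
  have xy : 0 < `|x| * `|y| by rewrite lt_neqAle eq_sym xy0 mulr_ge0.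
  rewrite -mulrA -ler_pdivrMr//; apply: lb_le_inf => // C [_ aC].
  by rewrite ler_pdivrMr// mulrA.
suff [] : (B `&` lbound B) (bilinear_norm a) by [].
apply: xgetPex; exists (inf B); split => // C BC; exact: ge_inf.
Qed.

Lemma bilinear_continuousl y : continuous (fun x => a x y : R^o).
Proof.
move=> x; apply: (@continuous_comp _ _ _ (fun x => (x, y))
  (fun p : X * Y => a p.1 p.2 : R^o)); last exact: ha.
by apply: cvg_pair; [exact: cvg_id|exact: cvg_cst].
Qed.

Lemma bilinear_continuousr x : continuous (fun y => a x y : R^o).
Proof.
move=> y; apply: (@continuous_comp _ _ _ (fun y => (x, y))
  (fun p : X * Y => a p.1 p.2 : R^o)); last exact: ha.
by apply: cvg_pair; [exact: cvg_cst|exact: cvg_id].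
Qed.

Lemma support_max_bound (PA : set X) y x : reflexive_space X -> closed PA ->
  convex_set PA -> bounded_set PA -> PA x -> a x y <= support_max a PA y.
Proof.
move=> rX clA cvA bA Ax.
have [||||z Az|z Az zmax] := @maximum_attained R X PA (fun x => a x y)
  (radius PA) (bilinear_norm a * radius PA * `|y|) rX.
- by exists x.
- move=> s; apply: closedI => //.
  apply: (@preimage_closed _ _ (fun x => a x y : R^o) [set r | s <= r]).
    by move=> ? _; exact: bilinear_continuousl.
  exact: closed_ge.
- move=> s; apply: comb_convex_set => t r u v [Au su] [Av sv] t0 r0 tr1.
  split; first exact: convex_set_comb.
  rewrite /= bilinearDl !bilinearZl -[leLHS]mul1r -tr1 mulrDl.
  by rewrite lerD// ler_wpM2l.
- by move=> z; exact: radius_bound.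
- have [b0 ab] := bilinear_norm_bound.
  apply: (le_trans (ler_norm _)); apply: (le_trans (ab _ _)).
  by rewrite ler_wpM2r// ler_wpM2l// radius_bound.
have -> : support_max a PA y = a z y.
  by apply: maximum_eq; [exists z|move=> _ [w Aw <-]; exact: zmax].
exact: zmax.
Qed.

(** The functional [F] is concave and continuous, and [F x <= |x| (M - |x|)] makes it nonpositive
    outside the ball of radius [M]. So its maximum over the part of [PC] in that ball is global, and
    it is at least [F 0 = 0], so that squaring undoes the root. *)
Lemma proj_norm_maximum (PC : set X) y : reflexive_space X -> closed PC ->
  convex_set PC -> PC 0 ->
  forall x, PC x -> - `|x| ^+ 2 + 2 * a x y <= proj_norm a PC y ^+ 2.
Proof.
move=> rX clC cvC C0; have [b0 ab] := bilinear_norm_bound.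
pose M := 2 * bilinear_norm a * `|y|.
have M0 : 0 <= M by rewrite !mulr_ge0.
pose F x := - `|x| ^+ 2 + 2 * a x y.
have FM x : F x <= `|x| * (M - `|x|).
  by have := le_trans (ler_norm _) (ab x y); rewrite /F /M; nra.
pose D := PC `&` [set x | `|x| <= M].
have [|||x [_ //]|x [_ /= xM]|z [Cz _] zmax] :=
    @maximum_attained R X D F M (M * M) rX.
- by exists 0; split; rewrite //= normr0.
- move=> s; apply: closedI; [apply: closedI => //|].
    apply: (@preimage_closed _ _ (fun x : X => `|x|) [set r | r <= M]).
      by move=> ? _; exact: norm_continuous.
    exact: closed_le.
  apply: (@preimage_closed _ _ (F : X -> R^o) [set r | s <= r]).
    move=> x _; apply: cvgD.
      by apply: cvgN; apply: cvgM; exact: norm_continuous.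
    by apply: cvgMr; exact: bilinear_continuousl.
  exact: closed_ge.
- move=> s; apply: comb_convex_set.
  move=> t r u v [[Cu Mu] su] [[Cv Mv] sv] t0 r0 tr1.
  have nuv : `|t *: u + r *: v| <= t * `|u| + r * `|v|.
    by rewrite (le_trans (ler_normD _ _))// !normrZ !ger0_norm.
  split; first split; first exact: convex_set_comb.
    apply: (le_trans nuv); rewrite -[leRHS]mul1r -tr1 mulrDl.
    by rewrite lerD// ler_wpM2l.
  move: su sv; rewrite /F /= bilinearDl !bilinearZl => su sv.
  have nuv2 : `|t *: u + r *: v| ^+ 2 <= (t * `|u| + r * `|v|) ^+ 2.
    by rewrite ler_pXn2r// nnegrE// addr_ge0// mulr_ge0.
  have rE : r = 1 - t by rewrite -tr1 addrAC subrr add0r.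
  have cvx : (t * `|u| + r * `|v|) ^+ 2 <= t * `|u| ^+ 2 + r * `|v| ^+ 2.
    rewrite -subr_ge0.
    have -> : t * `|u| ^+ 2 + r * `|v| ^+ 2 - (t * `|u| + r * `|v|) ^+ 2
      = t * r * (`|u| - `|v|) ^+ 2 by rewrite rE; ring.
    by rewrite mulr_ge0 ?sqr_ge0// mulr_ge0.
  have {}su : t * s <= t * (- `|u| ^+ 2 + 2 * a u y) by rewrite ler_wpM2l.
  have {}sv : r * s <= r * (- `|v| ^+ 2 + 2 * a v y) by rewrite ler_wpM2l.
  have -> : s = t * s + r * s by rewrite -mulrDl tr1 mul1r.
  move: su sv nuv2 cvx.
  move: (`|_| ^+ 2) (`|_| ^+ 2) (`|_| ^+ 2) (a u y) (a v y) => n1 n2 n3 a1 a2.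
  move: ((t * `|u| + r * `|v|) ^+ 2) => n4.
  by rewrite !mulrDr !mulrN; lra.
- apply: (le_trans (FM x)); have := normr_ge0 x; nra.
have F0 : F 0 = 0 by rewrite /F normr0 bilinear0l; lra.
have zmax' x : PC x -> F x <= F z.
  move=> Cx; have [xM|xM] := leP `|x| M; first exact: zmax.
  apply: (@le_trans _ _ (F 0)); last by apply: zmax; split; rewrite //= normr0.
  by rewrite F0 (le_trans (FM x))// mulr_ge0_le0// subr_le0 ltW.
have Fz0 : 0 <= F z by rewrite -F0; exact: zmax'.
have -> : proj_norm a PC y ^+ 2 = F z.
  rewrite /proj_norm (@maximum_eq _ _ (F z)) ?sqr_sqrtr//; first by exists z.
  by move=> _ [x Cx <-]; exact: zmax'.
exact: zmax'.
Qed.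

(** Among the multiples of [x], the factor [a x y / |x|^2] is optimal when [a x y > 0]; it yields
    [(a x y / |x|)^2] as a lower bound of the squared projection norm. *)
Lemma proj_norm_bound (PC : set X) y : reflexive_space X -> closed PC ->
  convex_set PC -> cone PC -> forall x, PC x -> a x y <= proj_norm a PC y * `|x|.
Proof.
move=> rX clC cvC coC x Cx.
have C0 : PC 0 by apply: closed_cone0 => //; exists x.
have p0 : 0 <= proj_norm a PC y by exact: sqrtr_ge0.
have [xE|x0] := eqVneq x 0; first by rewrite xE bilinear0l normr0 mulr0.
have nx : 0 < `|x| by rewrite normr_gt0.
have [a0|a0] := leP (a x y) 0; first by rewrite (le_trans a0)// mulr_ge0.
have t0 : 0 < a x y / `|x| ^+ 2 by rewrite divr_gt0// exprn_gt0.
have := proj_norm_maximum y rX clC cvC C0 (coC _ _ t0 Cx).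
rewrite bilinearZl normrZ gtr0_norm// => h.
rewrite -ler_pdivrMr// -(@ler_pXn2r _ 2)// ?nnegrE ?divr_ge0// ?(ltW a0)//.
apply: le_trans h; rewrite le_eqVlt; apply/orP; left; apply/eqP.
by field; rewrite gt_eqF.
Qed.

End BilinearForm.

(** * The inf-sup condition and the estimate of [zeta] *)

(** For [x != 0] the inner supremum at [x] is at most [M / |x|], which also makes [inf_sup] finite.
    The value [+oo] can occur only when [x = 0], treated first. *)
Lemma inf_sup_stability (R : realType) (X Y : normedModType R)
  (a : X -> Y -> R^o) (PC : set X) x (M : R) :
  (0 < inf_sup a PC)%E -> PC x -> 0 <= M -> (forall y, a x y <= M * `|y|) ->
  `|x| <= fine (inf_sup a PC)^-1%E * M.
Proof.
move=> c0 Cx M0 axM; have [->|x0] := eqVneq x 0.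
  by rewrite normr0 mulr_ge0// fine_ge0// inve_ge0 ltW.
have nx : 0 < `|x| by rewrite normr_gt0.
have : (inf_sup a PC <= (M / `|x|)%:E)%E.
  apply: ge_ereal_inf; exists (ereal_sup
    [set (a x y / (`|x| * `|y|))%:E | y in [set y : Y | y != 0]]).
    by exists x.
  apply/ereal_supP => _ [y /= y0 <-].
  have ny : 0 < `|y| by rewrite normr_gt0.
  rewrite lee_fin ler_pdivrMr ?mulr_gt0// (le_trans (axM y))//.
  by rewrite mulrA divfK// gt_eqF.
case: (inf_sup a PC) c0 => [r||] //; rewrite lte_fin lee_fin => r0 rM.
rewrite fine_invr -ler_pdivrMl ?invr_gt0// invrK.
by rewrite -ler_pdivlMr.
Qed.

Theorem theorem6p1 (R : realType)
  (X : completeNormedModType R) (hX : reflexive_space X)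
  (Y : completeNormedModType R) (dot : {dot Y for idfun})
  (hdot : forall y : Y, dot y y = `|y| ^+ 2)
  (a : {bilinear X -> Y -> R^o})
  (ha : continuous (fun p : X * Y => a p.1 p.2 : R^o))
  (L : {linear Y -> R^o}) (hL : continuous L) (hL0 : (L : Y -> R^o) <> 0)
  (P : set X) (hPcl : closed P) (hPcv : convex_set P) (hP0 : P 0)
  (PA : set X) (hAcl : closed PA) (hAcv : convex_set PA) (hAb : bounded_set PA)
  (PC : set X) (hCP : PC `<=` P)
  (hCcl : closed PC) (hCcv : convex_set PC) (hCc : cone PC)
  (hdec : forall x, P x -> exists xA xC, [/\ PA xA, PC xC & x = xA + xC])
  (c : \bar R) (hc : inf_sup a PC = c) (hc0 : (0 < c)%E)
  (Cs : R) (hCs : Cs = fine (c^-1)%E)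
  (y : Y) (hy : L y > Cs * proj_norm a PC y * dual_norm L) :
  (zeta a L P <=
    ((support_max a PA y + radius PA * Cs * bilinear_norm a * proj_norm a PC y)
       / (L y - Cs * proj_norm a PC y * dual_norm L))%:E)%E.
Proof.
have ipC u v : dot u v = dot v u by rewrite hermC expr0 mul1r.
have ipP k u v w : dot (k *: u + v) w = k * dot u w + dot v w.
  exact: linearPl.
have [b0 ab] := bilinear_norm_bound ha.
have riesz_a x : exists r, forall v, a x v = dot v r.
  apply: (riesz ipC ipP hdot); split; last exact: bilinear_continuousr.
  by move=> k u v; exact: linearPr.
have [A aA] := choice riesz_a.
(* Both sides have the same inner product with every vector, in particular with their difference
   [e]. *)
have AP k u v : A (k *: u + v) = k *: A u + A v.
  set w := k *: A u + A v; apply/eqP; rewrite -subr_eq0 -normr_eq0 -sqrf_eq0 -hdot.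
  set e := A _ - w.
  rewrite {2}/e (ipDr ipC ipP) (ipNr ipC ipP) -aA /w.
  rewrite (ipDr ipC ipP) (ipZr ipC ipP) -!aA bilinearDl bilinearZl.
  by rewrite subrr.
have A0 : A 0 = 0.
  by have := AP (-1) 0 0; rewrite scaler0 addr0 scaleN1r addNr.
have AZ k u : A (k *: u) = k *: A u by rewrite -[_ *: u]addr0 AP A0 addr0.
(* Decomposing 0 shows that [PA] and [PC] are nonempty; it also gives the sign of [N] below. *)
have [zA [zC [AzA CzC z0]]] := hdec 0 hP0.
have C0 : PC 0 by apply: closed_cone0 => //; exists zC.
set p := proj_norm a PC y in hy *.
have p0 : 0 <= p by exact: sqrtr_ge0.
have Cs0 : 0 <= Cs by rewrite hCs fine_ge0// inve_ge0 ltW.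
have stab x : PC x -> `|x| <= Cs * `|A x|.
  move=> Cx; rewrite hCs -hc; apply: inf_sup_stability => //; first by rewrite hc.
  by move=> v; rewrite aA mulrC; exact: (ip_cauchy_schwarz ipC ipP hdot).
have dL : continuous_dual (L : Y -> R^o) by split => // k u v; exact: linearP.
have [|||k [x Cx <-]||w wp wP] := @polar_cone_correction _ _ dot ipC ipP hdot
    [set A x | x in PC] y (Cs * p).
- by exists 0.
- apply: comb_convex_set => s t _ _ [u Cu <-] [v Cv <-] s0 t0 st1.
  by exists (s *: u + t *: v); [exact: convex_set_comb|rewrite AP AZ].
- by move=> t _ t0 [x Cx <-]; exists (t *: x); [exact: hCc|rewrite AZ].
(* For [k = A x] this chains [a x y <= p |x|] with [|x| <= Cs |A x|]. *)
- rewrite ipC -aA (le_trans (proj_norm_bound ha y hX hCcl hCcv hCc Cx))//.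
  by rewrite mulrAC [leRHS]mulrC ler_wpM2l// stab.
- exact: mulr_ge0.
pose u := y - w.
have au x : PC x -> a x u <= 0 by move=> Cx; rewrite aA ipC; apply: wP; exists x.
set D := L y - _; set N := _ + _.
have D0 : 0 < D by rewrite subr_gt0.
(* The loss [L w] is at most the dual norm of [L] times [|w| <= Cs * p]. *)
have DL : D <= L u.
  rewrite /D /u linearB lerB//; apply: (le_trans (ler_norm _)).
  apply: (le_trans (dual_norm_bound _ dL)).
  by rewrite mulrC ler_wpM2r// dual_norm_ge0.
have Lu0 : 0 < L u by exact: lt_le_trans DL.
have aN x : PA x -> a x u <= N.
  move=> Ax; rewrite /u bilinearDr lerD//; first exact: support_max_bound.
  have -> : a x (- w) = - a x w by exact: linearNr.
  apply: (le_trans (ler_norm _)); rewrite normrN (le_trans (ab _ _))//.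
  have -> : radius PA * Cs * bilinear_norm a * p
    = bilinear_norm a * radius PA * (Cs * p) by ring.
  rewrite ler_pM ?mulr_ge0// ler_wpM2l// radius_bound//.
(* From [0 = zA + zC] and [a zC u <= 0] follows [a zA u >= 0]. The sign is what allows [L u] to be
   replaced by the smaller [D] in the denominator. *)
have N0 : 0 <= N.
  apply: le_trans (aN _ AzA).
  by have := au _ CzC; have := bilinearDl a zA zC u; rewrite -z0 bilinear0l; lra.
apply: ge_ereal_inf; exists (ereal_sup [set (a x ((L u)^-1 *: u))%:E | x in P]).
  exists ((L u)^-1 *: u) => //=.
  by rewrite linearZ /= -[_ *: _]/(_ * _) mulVf// gt_eqF.
apply/ereal_supP => _ [x Px <-]; rewrite lee_fin bilinearZr.
have [xA [xC [AxA CxC ->]]] := hdec x Px.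
rewrite bilinearDl mulrC; apply: (@le_trans _ _ (N / L u)).
  apply: ler_wpM2r; first by rewrite invr_ge0 ltW.
  by rewrite -[leRHS]addr0; apply: lerD; [exact: aN|exact: au].
by rewrite ler_wpM2l// lef_pV2.
Qed.
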